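(* Let $\Lambda$ be a mother process, let $b>1$, and let $A_n(t)$, $t\in[0,1]$, be the associated cumulative processes (see context). Put $\rho(u)=\mathrm{E}\,\Lambda(0)\Lambda(u)$, $u\ge 0$. Assume that $\rho(u)$ is monotone decreasing in $u$, that $$b>\mathrm{E}\,\Lambda(0)^2,$$ and that $$\sum_{i=0}^{\infty}\bigl(\rho(b^i)-1\bigr)<\infty .$$ Then $A_n(t)$ converges in $\mathcal{L}_2$ (and hence in $\mathcal{L}_q$ for $q\in[0,2]$) as $n\to\infty$, for every fixed $t\in[0,1]$.
   Context: Mother process: $\Lambda(t)$, $t\in\mathbb{R}_+=[0,\infty)$, is a measurable, separable, strictly stationary, positive stochastic process with $\mathrm{E}\Lambda(t)=1$. Let $\Lambda^{(i)}$, $i=0,1,2,\dots$, be independent copies of $\Lambda$, let $b>1$ be the scaling parameter, and let $\Lambda_b^{(i)}(t)=\Lambda^{(i)}(tb^i)$ (equality in finite-dimensional distributions) be the rescaled copies, independent in $i$. Define $$\Lambda_n(t)=\prod_{i=0}^n\Lambda_b^{(i)}(t),\qquad A_n(t)=\int_0^t\Lambda_n(s)\,ds,\qquad n=0,1,2,\dots,\ t\in[0,1].$$ Convergence in $\mathcal{L}_q$, $q>0$, means $\mathrm{E}|A_n(t)-A(t)|^q\to0$ for some limit random variable $A(t)$ (with finite $q$-th absolute moment); $\mathcal{L}_0$ convergence is understood as convergence in probability. *)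

(* Defs.v *)
From HB Require Import structures.
From mathcomp Require Import all_boot all_order all_algebra.
From mathcomp Require Import all_classical all_reals all_analysis.

Set Implicit Arguments.
Unset Strict Implicit.
Unset Printing Implicit Defensive.

Import Order.TTheory GRing.Theory Num.Theory.
Import numFieldNormedType.Exports.

Local Open Scope classical_set_scope.
Local Open Scope ring_scope.

(* A process indexed by [0, +oo[ is a function X : R -> T -> R; its values at
   negative times are irrelevant and never used below. *)

Section processes.
Context d (T : measurableType d) (R : realType) (P : probability T R).
Implicit Type X : R -> T -> R.

Definition measurable_process X : Prop :=
  measurable_fun (`[0, +oo[ `*` [set: T] : set (measurableTypeR R * T))
    (fun z : measurableTypeR R * T => X z.1 z.2).

(* Doob separability, relative to the class of closed sets. *)
Definition separable_process X : Prop :=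
  exists (S : set R) (N : set T),
    [/\ S `<=` `[0, +oo[, countable S, P.-negligible N &
        forall (u v : R) (F : set R), closed F ->
          [set w | forall t, u < t < v -> S t -> F (X t w)] `\`
          [set w | forall t, u < t < v -> 0 <= t -> F (X t w)] `<=` N].

(* The law on R^n of (X t_1, ..., X t_n), with the product sigma-algebra on
   n-tuples. *)
Definition fdd X n (t : n.-tuple R) (B : set (n.-tuple (measurableTypeR R))) :
    \bar R :=
  P [set w | B [tuple X (tnth t k) w | k < n]].

(* The events determined by the whole process. *)
Definition process_sigma X : set (set T) :=
  <<s [set E | exists (t : R) (B : set R),
         [/\ 0 <= t, measurable B & E = X t @^-1` B]] >>.

Definition independent_processes (X : nat -> R -> T -> R) : Prop :=
  forall (J : seq nat) (E : nat -> set T), uniq J ->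
    (forall i, i \in J -> process_sigma (X i) (E i)) ->
    P (\big[setI/setT]_(i <- J) E i) = (\prod_(i <- J) P (E i))%E.

Definition autocorrelation X (u : R) : \bar R :=
  ('E_P[fun w => (X 0 w * X u w)%R])%E.

(* Convergence in L_q; for q = 0 it means convergence in probability. *)
Definition cvg_Lq (q : R) (Y : nat -> T -> R) (Z : T -> R) : Prop :=
  if q == 0 then
    forall e : R, 0 < e ->
      P [set w | e <= `|Y n w - Z w|] @[n --> \oo] --> 0%E
  else
    ('E_P[fun w => (`|Z w| `^ q)%R] < +oo)%E /\
    ('E_P[fun w => (`|Y n w - Z w| `^ q)%R])%E @[n --> \oo] --> 0%E.

End processes.

Definition same_fdd d (T : measurableType d) d' (T' : measurableType d')
    (R : realType) (P : probability T R) (P' : probability T' R)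
    (X : R -> T -> R) (X' : R -> T' -> R) : Prop :=
  forall n (t : n.-tuple R) (B : set (n.-tuple (measurableTypeR R))),
    (forall k, 0 <= tnth t k) -> measurable B ->
    fdd P X t B = fdd P' X' t B.

Definition strictly_stationary d (T : measurableType d) (R : realType)
    (P : probability T R) (X : R -> T -> R) : Prop :=
  forall h : R, 0 <= h -> same_fdd P P (fun t => X (t + h)) X.

Record mother_process d (T : measurableType d) (R : realType)
    (P : probability T R) (X : R -> T -> R) : Prop := MotherProcess {
  mother_measurable : measurable_process X ;
  mother_separable : separable_process P X ;
  mother_stationary : strictly_stationary P X ;
  mother_positive : forall t, 0 <= t -> {ae P, forall w, 0 < X t w} ;
  mother_mean : forall t, 0 <= t -> ('E_P[X t] = 1)%E }.

Section cumulative.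
Context d (T : measurableType d) (R : realType).
Variable Lb : nat -> R -> T -> R.

Definition product_process (n : nat) (t : R) (w : T) : R :=
  \prod_(i < n.+1) Lb i t w.

Definition cumulative_process (n : nat) (t : R) (w : T) : R :=
  (\int[lebesgue_measure]_(s in `[0%R, t]) product_process n s w)%R.

End cumulative.

(* Main.v *)
(* Let r be the autocorrelation of the mother process and A_n = A_n(t).  By
   independence and unit means, E A_m A_n is for all m <= n the double integral
   over [0,t]^2 of prod_(i <= m) r(|s - u| b^i), so it depends on m only and
   E (A_n - A_m)^2 = E A_n^2 - E A_m^2: it suffices to bound E A_n^2.
   Since r >= 1 (a decreasing stationary covariance is nonnegative) and the sum
   of r(b^i) - 1 converges, C = sup_n prod_(i < n) r(b^i) is finite.  Moreover
   b^-k <= |s - u| gives prod_i r(|s - u| b^i) <= C r(0)^k, while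
   |s - u| < b^-k has measure at most 2 b^-k; summing over k, the second
   moments are bounded by a geometric series of ratio r(0) / b < 1. *)

Require Import Defs.
From HB Require Import structures.
From mathcomp Require Import all_boot all_order all_algebra.
From mathcomp Require Import all_classical all_reals all_analysis.
From mathcomp Require Import measurable_realfun ring lra zify.

Set Implicit Arguments.
Unset Strict Implicit.
Unset Printing Implicit Defensive.

Import Order.TTheory GRing.Theory Num.Theory.
Import numFieldNormedType.Exports.

Local Open Scope classical_set_scope.
Local Open Scope ring_scope.

(** The rescaled copies [Lb i] are known only through their finite-dimensional laws, so each is
    nonnegative only a.e. at each fixed time, with an exceptional set that depends on the time.
    Moments are therefore computed for absolute values, where Tonelli and the transfer between laws
    need no integrability. A Tonelli argument on the negative part then shows that almost every path
    integral of the product equals that of its absolute value. The martingale structure enters only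
    through the mixed moments, so no filtration or conditional expectation appears: L_2 completeness
    replaces martingale convergence. *)

(** * Completeness of L_2 of a probability space *)

Section L2_completeness.
Local Open Scope ereal_scope.
Context d (T : measurableType d) (R : realType).

(** Fatou's lemma for the lower limit, which agrees a.e. with [g]; a lower limit ignores the indices
    below [K]. *)
Lemma ae_limit_integral_le (mu : {measure set T -> \bar R})
    (f : nat -> T -> \bar R) (g : T -> \bar R) (c : \bar R) (K : nat) :
  (forall k, measurable_fun setT (f k)) -> (forall k x, 0 <= f k x) ->
  measurable_fun setT g -> (forall x, 0 <= g x) ->
  {ae mu, forall x, f ^~ x @ \oo --> g x} ->
  (forall k, (K <= k)%N -> \int[mu]_x f k x <= c) ->
  \int[mu]_x g x <= c.
Proof.
move=> mf f0 mg g0 fg fc.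
have mlim : measurable_fun setT (fun x => limn_einf (f ^~ x)).
  rewrite /limn_einf; apply: measurableT_comp => //.
  apply: (measurable_fun_limn_esup (f := fun k x => - f k x)) => k.
  exact: measurableT_comp.
have lim0 x : 0 <= limn_einf (f ^~ x).
  rewrite limn_einf_lim; apply: lime_ge; first exact: is_cvg_einfs.
  by apply: nearW => n; apply: le_ereal_inf_tmp => _ [k _ <-].
rewrite (_ : \int[mu]_x g x = \int[mu]_x limn_einf (f ^~ x)).
  apply: (le_trans (fatou mu measurableT mf (fun k x _ => f0 k x))).
  rewrite limn_einf_lim; apply: lime_le; first exact: is_cvg_einfs.
  apply: nearW => n; apply: (@le_trans _ _ (\int[mu]_x f (maxn n K) x)).
    by apply: ereal_inf_lbound; exists (maxn n K) => //=; exact: leq_maxl.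
  by apply: fc; exact: leq_maxr.
apply: ae_eq_integral => //.
apply: filterS fg => x fgx _.
by have [-> _] := cvg_limn_einf_sup fgx.
Qed.

Variable P : probability T R.

(** Valid in the extended reals. Pointwise bounds by [a + c * x ^+ 2], integrated with this
    identity, stand in for the Cauchy-Schwarz and Hölder inequalities throughout. *)
Lemma integral_affine_sqr (f : T -> R) (a c : R) : measurable_fun setT f ->
  (0 <= a)%R -> (0 <= c)%R ->
  \int[P]_w (a + c * f w ^+ 2)%:E = a%:E + c%:E * \int[P]_w (f w ^+ 2)%:E.
Proof.
move=> mf a0 c0.
have mf2 : measurable_fun setT (fun w => (f w ^+ 2)%:E).
  by apply/measurable_EFinP; exact: measurable_funX.
under eq_integral do rewrite EFinD EFinM.
rewrite ge0_integralD//.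
- rewrite integral_cst//= probability_setT mule1 ge0_integralZl//.
  by move=> w _; rewrite lee_fin sqr_ge0.
- by move=> w _; rewrite -EFinM lee_fin mulr_ge0 ?sqr_ge0.
- exact: emeasurable_funM.
Qed.

(** Riesz-Fischer: a subsequence with geometrically small increments converges a.e., and Fatou
    carries the Cauchy estimate to its limit. *)
Lemma L2_complete (X : nat -> T -> R) :
  (forall n, measurable_fun setT (X n)) ->
  (forall e : R, (0 < e)%R -> exists N, forall m n, (N <= m)%N -> (N <= n)%N ->
     \int[P]_w ((X n w - X m w) ^+ 2)%:E <= e%:E) ->
  exists Z : T -> R, measurable_fun setT Z /\
    forall e : R, (0 < e)%R -> exists N, forall n, (N <= n)%N ->
      \int[P]_w ((X n w - Z w) ^+ 2)%:E <= e%:E.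
Proof.
move=> mX cX.
have e0 k : (0 < ((2 ^ k.+1)%:R^-1 ^+ 2 : R))%R.
  by rewrite exprn_gt0// invr_gt0 ltr0n expn_gt0.
have /choice[N0 N0P] : forall k, exists N, forall m n, (N <= m)%N -> (N <= n)%N ->
   \int[P]_w ((X n w - X m w) ^+ 2)%:E <= ((2 ^ k.+1)%:R^-1 ^+ 2)%:E.
  by move=> k; exact: cX.
(* Summing all earlier thresholds puts both [phi k] and [phi k.+1] beyond [N0 k]. *)
pose phi k := (k + \sum_(j < k.+1) N0 j)%N.
have phi_id k : (k <= phi k)%N by exact: leq_addr.
have phiN k : (N0 k <= phi k)%N.
  by rewrite /phi big_ord_recr/= addnA leq_addl.
have phiSN k : (N0 k <= phi k.+1)%N.
  by rewrite /phi 2!big_ord_recr/=; lia.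
pose dX k w := (X (phi k.+1) w - X (phi k) w)%R.
have mdX k : measurable_fun setT (dX k) by exact: measurable_funB.
have mndX k : measurable_fun setT (fun w => `|dX k w|%:E).
  by apply/measurable_EFinP; exact: measurableT_comp.
have idX k : \int[P]_w `|dX k w|%:E <= (1 / (2 ^ k.+1)%:R)%:E.
  set a : R := (2 ^ k.+1)%:R.
  have a0 : (0 < a)%R by rewrite ltr0n expn_gt0.
  (* Expanded from (a|x| - 1)^2 >= 0. The weights are balanced for a second moment of at most a^-2:
     both terms then integrate to at most a^-1 / 2. *)
  have pt x : (`|x| <= a^-1 / 2 + a / 2 * x ^+ 2)%R.
    have := sqr_ge0 (a * `|x| - 1)%R.
    rewrite sqrrB1 exprMn real_normK ?num_real// => h.
    rewrite -(ler_pM2l (_ : 0 < a * 2)%R); last by rewrite mulr_gt0.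
    have -> : (a * 2 * (a^-1 / 2 + a / 2 * x ^+ 2) = 1 + a ^+ 2 * x ^+ 2)%R.
      by field; rewrite gt_eqF.
    by move: h; lra.
  apply: (@le_trans _ _ (\int[P]_w (a^-1 / 2 + a / 2 * dX k w ^+ 2)%:E)).
    apply: ge0_le_integral => //.
    - apply/measurable_EFinP/measurable_funD => //.
      by apply: measurable_funM => //; exact: measurable_funX.
    - by move=> w _; rewrite lee_fin; exact: pt.
  rewrite integral_affine_sqr//; last 2 first.
  - by rewrite divr_ge0// invr_ge0 ltW.
  - by rewrite divr_ge0// ltW.
  apply: (@le_trans _ _ ((a^-1 / 2)%:E + (a / 2)%:E * (a^-1 ^+ 2)%:E)).
    rewrite leeD2l// lee_pmul2l ?lte_fin ?divr_gt0//.
    exact: N0P (phiN k) (phiSN k).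
  rewrite -EFinM -EFinD lee_fin le_eqVlt; apply/orP; left; apply/eqP.
  by field; rewrite gt_eqF.
have isum : \int[P]_w (\sum_(k <oo) `|dX k w|%:E) <= 1%:E.
  rewrite integral_nneseries//.
  apply: le_trans (epsilon_trick0 xpredT ler01).
  by apply: lee_nneseries => // k _ _; exact: integral_ge0.
have msum : measurable_fun setT (fun w => \sum_(k <oo) `|dX k w|%:E).
  by apply: ge0_emeasurable_sum.
have aesum : {ae P, forall w, [set: T] w -> (\sum_(k <oo) `|dX k w|%:E) \is a fin_num}.
  apply: integrable_ae => //; apply/integrableP; split => //.
  under eq_integral do rewrite gee0_abs ?nneseries_ge0//.
  by rewrite (le_lt_trans isum)// ltry.
(* An upper limit is measurable even where the subsequence diverges; [fine] gives a harmless real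
   value there. *)
pose Z w := fine (limn_esup (fun k => (X (phi k) w)%:E)).
have mZ : measurable_fun setT Z.
  apply: (measurableT_comp (fine_measurable measurableT)).
  by apply: measurable_fun_limn_esup => k; exact/measurable_EFinP.
have XZ : {ae P, forall w, X (phi k) w @[k --> \oo] --> Z w}.
  apply: filterS aesum => w /(_ I) wfin.
  have /normed_cvg : cvgn [normed series (dX ^~ w)].
    apply: nondecreasing_is_cvgn.
      by apply: nondecreasing_series => *; rewrite normr_ge0.
    exists (fine (\sum_(k <oo) `|dX k w|%:E)) => _ [n _ <-].
    rewrite -lee_fin fineK// /normed_series_of seriesEnat/= -sumEFin.
    by apply: nneseries_lim_ge.
  have -> : series (dX ^~ w) = (fun n => X (phi n) w - X (phi 0%N) w)%R.
    exact: (telescopeK (fun k => X (phi k) w)).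
  move=> cv.
  have {}cv : cvgn (fun k => X (phi k) w).
    rewrite (_ : (fun k => _) =
        (fun n => (X (phi n) w - X (phi 0%N) w) + X (phi 0%N) w)%R).
      by apply: is_cvgD => //; exact: is_cvg_cst.
    by apply/funext => n; rewrite subrK.
  rewrite /Z; have /cvg_limn_einf_sup[_ ->] // :
    (X (phi k) w)%:E @[k --> \oo] --> (limn (fun k => X (phi k) w))%:E.
  by apply: cvg_EFin => //; exact: nearW.
exists Z; split => // e e1; have [N NP] := cX _ e1; exists N => n Nn.
apply: (@ae_limit_integral_le P (fun k w => ((X n w - X (phi k) w) ^+ 2)%:E) _ _ N) => //.
- by move=> k; apply/measurable_EFinP/measurable_funX/measurable_funB.
- by move=> k w; rewrite lee_fin sqr_ge0.
- by apply/measurable_EFinP/measurable_funX/measurable_funB.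
- by move=> w; rewrite lee_fin sqr_ge0.
- apply: filterS XZ => w wZ; apply: cvg_EFin; first exact: nearW.
  have h : (X n w - X (phi k) w)%R @[k --> \oo] --> (X n w - Z w)%R.
    by apply: cvgB => //; exact: cvg_cst.
  exact: (cvgM h h).
- by move=> k Nk; apply: NP => //; exact: leq_trans (phi_id k).
Qed.

End L2_completeness.

(** * From L_2 convergence to L_q convergence, q in [0, 2] *)

Section Lq_from_L2.
Local Open Scope ereal_scope.
Context d (T : measurableType d) (R : realType) (P : probability T R).

Lemma cvge0_le_eps (u : nat -> \bar R) : (forall n, 0 <= u n) ->
  (forall e : R, (0 < e)%R -> exists N, forall n, (N <= n)%N -> u n <= e%:E) ->
  u @ \oo --> 0.
Proof.
move=> u0 ue; apply: limn_esup_le_cvg => //; apply/lee_addgt0Pr => e e0.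
rewrite add0e limn_esup_lim; have [N NP] := ue e e0.
apply: lime_le; first exact: is_cvg_esups.
exists N => // n Nn; apply: ge_ereal_sup => _ [k /= nk <-].
by apply: NP; exact: leq_trans nk.
Qed.

Lemma powR_le_affine_sqr (q y : R) : (0 <= q <= 2)%R -> (0 <= y)%R ->
  (y `^ q <= 1 + y ^+ 2)%R.
Proof.
move=> /andP[q0 q2] y0; have [y1|/ltW y1] := leP y 1%R.
  apply: (@le_trans _ _ (1 `^ q)%R); last by rewrite powR1 lerDl sqr_ge0.
  by apply: ge0_ler_powR; rewrite ?nnegrE.
apply: (@le_trans _ _ (y `^ 2)%R); first exact: ler_powR.
by rewrite powR_mulrn// lerDr.
Qed.

Lemma L2_cvg_Lq (Y : nat -> T -> R) (Z : T -> R) (q : R) :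
  (forall n, measurable_fun setT (Y n)) -> measurable_fun setT Z ->
  \int[P]_w (Z w ^+ 2)%:E < +oo ->
  (forall e : R, (0 < e)%R -> exists N, forall n, (N <= n)%N ->
      \int[P]_w ((Y n w - Z w) ^+ 2)%:E <= e%:E) ->
  (0 <= q <= 2)%R -> cvg_Lq P q Y Z.
Proof.
move=> mY mZ Z2 YZ q02; rewrite /cvg_Lq.
have mD n : measurable_fun setT (fun w => Y n w - Z w)%R by exact: measurable_funB.
case: eqVneq => [_ e e0|q0].
  apply: cvge0_le_eps => // eta eta0.
  have ee0 : (0 < e ^+ 2)%R by rewrite exprn_gt0.
  (* Chebyshev: e^2 times the probability is at most the second moment, so the factor e^2
     cancels. *)
  have [N NP] := YZ (eta * e ^+ 2)%R (mulr_gt0 eta0 ee0); exists N => n Nn.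
  have mg : measurable_fun setT (fun w => ((Y n w - Z w) ^+ 2)%:E).
    by apply/measurable_EFinP/measurable_funX.
  have := le_integral_abse P measurableT mg ee0.
  rewrite setTI (_ : [set x | _] = [set w | (e <= `|Y n w - Z w|)%R]); last first.
    apply/funext => w; apply/propext => /=.
    rewrite lee_fin ger0_norm ?sqr_ge0// -[((_ - _) ^+ 2)%R]real_normK ?num_real//.
    by rewrite ler_pXn2r// nnegrE ltW.
  under eq_integral do rewrite gee0_abs ?lee_fin ?sqr_ge0//.
  move=> /le_trans/(_ (NP _ Nn));
  rewrite [(eta * _)%R]mulrC [(_ * eta)%:E]EFinM lee_pmul2l ?lte_fin//.
have qgt0 : (0 < q)%R by rewrite lt_def q0; case/andP: q02.
split.
  rewrite unlock; apply: (@le_lt_trans _ _ (\int[P]_w (1 + 1 * Z w ^+ 2)%:E)).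
    apply: ge0_le_integral => //.
    - apply/measurable_EFinP; apply: (measurableT_comp (measurable_powR q)).
      exact: measurableT_comp.
    - apply/measurable_EFinP/measurable_funD => //; apply: measurable_funM => //.
      exact: measurable_funX.
    - move=> w _; rewrite lee_fin mul1r -[X in (_ + X)%R]real_normK ?num_real//.
      exact: powR_le_affine_sqr.
  by rewrite integral_affine_sqr// mul1e lte_add_pinfty// ltry.
apply: cvge0_le_eps => [n|e e0].
  by apply: expectation_ge0 => w; exact: powR_ge0.
(* Chosen so that del^q = e / 2. Rescaling [powR_le_affine_sqr] by [del] gives |x|^q <= (e / 2) (1 +
   (|x| / del)^2), and a second moment of at most del^2 makes the total at most e. *)
pose del := ((e / 2) `^ q^-1)%R.
have e20 : (0 < e / 2)%R by rewrite divr_gt0.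
have del0 : (0 < del)%R by rewrite powR_gt0.
have delq : (del `^ q = e / 2)%R.
  by rewrite -powRrM mulVf// powRr1// ltW.
have [N NP] := YZ (del ^+ 2)%R (exprn_gt0 2 del0); exists N => n Nn.
rewrite unlock.
apply: (@le_trans _ _ (\int[P]_w (e / 2 + (e / 2 / del ^+ 2) * (Y n w - Z w) ^+ 2)%:E)).
  apply: ge0_le_integral => //.
  - apply/measurable_EFinP; apply: (measurableT_comp (measurable_powR q)).
    exact: measurableT_comp.
  - apply/measurable_EFinP/measurable_funD => //; apply: measurable_funM => //.
    exact: measurable_funX.
  - move=> w _; rewrite lee_fin.
    set x := (Y n w - Z w)%R.
    have -> : (`|x| = del * (`|x| / del))%R by rewrite mulrC divfK ?gt_eqF.
    rewrite powRM ?(ltW del0)//; last by rewrite divr_ge0// ltW.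
    have -> : (e / 2 + e / 2 / del ^+ 2 * x ^+ 2 = e / 2 * (1 + (`|x| / del) ^+ 2))%R.
      by rewrite expr_div_n real_normK ?num_real//; field; rewrite gt_eqF.
    rewrite delq ler_pM2l//; apply: powR_le_affine_sqr => //.
    by rewrite divr_ge0// ltW.
rewrite integral_affine_sqr//; last 2 first.
- exact: ltW.
- by rewrite divr_ge0 ?sqr_ge0// ltW.
apply: (@le_trans _ _ ((e / 2)%:E + (e / 2 / del ^+ 2)%:E * (del ^+ 2)%:E)).
  by rewrite leeD2l// lee_pmul2l ?lte_fin ?divr_gt0 ?exprn_gt0//; exact: NP.
rewrite -EFinM -EFinD lee_fin divfK ?gt_eqF ?exprn_gt0//; lra.
Qed.

End Lq_from_L2.

(** * Tonelli's theorem over a measurable set of times *)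

Section fubini_tonelli_on.
Local Open Scope ereal_scope.
Context d1 d2 (S : measurableType d1) (T : measurableType d2) (R : realType).
Variables (m1 : {sigma_finite_measure set S -> \bar R}).
Variables (m2 : {sigma_finite_measure set T -> \bar R}).
Variable (D : set S).
Hypothesis mD : measurable D.

Section one_function.
Variable f : S * T -> \bar R.
Hypothesis mf : measurable_fun (D `*` [set: T]) f.
Hypothesis f0 : forall x, D x.1 -> 0 <= f x.

(** Extension by zero reduces everything to Tonelli on the full product; [f] itself is controlled
    only over [D], as a process is only at nonnegative times. *)
Let g := f \_ (D `*` [set: T]).

Let mg : measurable_fun setT g.
Proof.
by apply/(measurable_restrictT _ _).1 => //; exact: measurableX.
Qed.

Let g0 x : 0 <= g x.
Proof.
by rewrite /g /patch; case: ifPn => //; rewrite inE => -[/f0].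
Qed.

Let gE y : (fun x => g (x, y)) = (fun x => f (x, y)) \_ D.
Proof.
apply/funext => x; rewrite /g /patch.
suff -> : ((x, y) \in D `*` [set: T]) = (x \in D) by [].
by apply/idP/idP; rewrite !inE/=; [case|].
Qed.

Lemma measurable_integral_on : measurable_fun setT (fun y => \int[m1]_(x in D) f (x, y)).
Proof.
under eq_fun do rewrite integral_mkcond -gE.
exact: (measurable_fun_fubini_tonelli_G g).
Qed.

Lemma measurable_integral_section : measurable_fun D (fun x => \int[m2]_y f (x, y)).
Proof.
apply: (eq_measurable_fun (fun x => \int[m2]_y g (x, y))).
  move=> x xD; apply: eq_integral => y _.
  by have /(congr1 (@^~ x)) -> := gE y; rewrite patchT.
apply: measurable_funTS; exact: (measurable_fun_fubini_tonelli_F g).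
Qed.

Lemma fubini_tonelli_on :
  \int[m1]_(x in D) \int[m2]_y f (x, y) = \int[m2]_y \int[m1]_(x in D) f (x, y).
Proof.
under [RHS]eq_integral do rewrite integral_mkcond -gE.
rewrite -(fubini_tonelli g)// [LHS]integral_mkcond; apply: eq_integral => x _.
rewrite /patch; case: ifPn => xD.
  apply: eq_integral => y _.
  by have /(congr1 (@^~ x)) -> := gE y; rewrite patchT.
rewrite (eq_integral (fun=> 0)) ?integral0// => y _.
by have /(congr1 (@^~ x)) -> := gE y; rewrite patchN.
Qed.

End one_function.

Lemma measurable_fun_section2 (f : S * T -> \bar R) x : D x ->
  measurable_fun (D `*` [set: T]) f -> measurable_fun setT (fun y => f (x, y)).
Proof.
move=> Dx mf.
apply: (measurable_comp (F := D `*` [set: T]) (f := f) (g := fun y => (x, y))) => //.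
- exact: measurableX.
- by move=> _ [y _ <-].
- exact: measurable_pair1.
Qed.

Lemma measurable_fun_section1 (f : S * T -> \bar R) y :
  measurable_fun (D `*` [set: T]) f -> measurable_fun D (fun x => f (x, y)).
Proof.
move=> mf.
apply: (measurable_comp (F := D `*` [set: T]) (f := f) (g := fun x => (x, y))) => //.
- exact: measurableX.
- by move=> _ [x Dx <-].
- by apply: measurable_funTS; exact: measurable_pair2.
Qed.

(** Tonelli is applied once for each of the two time variables. Values may be infinite, so this
    holds before any second moment is known to be finite. *)
Lemma integral_mul_integrals_on (f g : S * T -> \bar R) :
  measurable_fun (D `*` [set: T]) f -> measurable_fun (D `*` [set: T]) g ->
  (forall x, 0 <= f x) -> (forall x, 0 <= g x) ->
  \int[m2]_y (\int[m1]_(x in D) f (x, y) * \int[m1]_(x in D) g (x, y)) =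
  \int[m1]_(x in D) \int[m1]_(x' in D) \int[m2]_y (f (x, y) * g (x', y)).
Proof.
move=> mf mg f0 g0.
have mig : measurable_fun setT (fun y => \int[m1]_(x in D) g (x, y)).
  by apply: measurable_integral_on => // x _; exact: g0.
have ig0 y : 0 <= \int[m1]_(x in D) g (x, y) by exact: integral_ge0.
transitivity (\int[m2]_y \int[m1]_(x in D)
    (f (x, y) * \int[m1]_(x' in D) g (x', y))).
  apply: eq_integral => y _; rewrite ge0_integralZr//.
  exact: measurable_fun_section1.
rewrite -(fubini_tonelli_on
  (f := fun z => f z * \int[m1]_(x' in D) g (x', z.2))); last 2 first.
- apply: emeasurable_funM => //; apply: measurable_funTS.
  exact: (measurableT_comp mig).
- by move=> x _; rewrite mule_ge0.
apply: eq_integral => x; rewrite inE => Dx.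
have mfx := measurable_fun_section2 Dx mf.
transitivity (\int[m2]_y \int[m1]_(x' in D) (f (x, y) * g (x', y))).
  apply: eq_integral => y _; rewrite ge0_integralZl//.
  exact: measurable_fun_section1.
rewrite -(fubini_tonelli_on (f := fun z => f (x, z.2) * g z))//.
- apply: emeasurable_funM => //; apply: measurable_funTS.
  exact: (measurableT_comp mfx).
- by move=> z _; rewrite mule_ge0.
Qed.

End fubini_tonelli_on.

(** * Expectation of a product of independent factors *)

Section independence.
Local Open Scope ereal_scope.
Context d (T : measurableType d) (R : realType) (P : probability T R).

(* Layer-cake representation [X w = \int_(0 <= r) 1_(r < X w)] and Tonelli. *)
Lemma integral_mul_of_tails (X Y : T -> R) (c : \bar R) :
  measurable_fun setT X -> measurable_fun setT Y ->
  (forall w, (0 <= X w)%R) -> (forall w, (0 <= Y w)%R) -> 0 <= c ->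
  (forall r : R, \int[P]_w (\1_[set w | (r < X w)%R] w * Y w)%:E =
                 P [set w | (r < X w)%R] * c) ->
  \int[P]_w (X w * Y w)%:E = (\int[P]_w (X w)%:E) * c.
Proof.
move=> mX mY X0 Y0 c0 tails.
pose D : set (measurableTypeR R) := `[0%R, +oo[%classic.
have mD : measurable D by exact: measurable_itv.
pose A : set (measurableTypeR R * T) := [set z | (z.1 < X z.2)%R].
have mA : measurable A.
  have mXs : measurable_fun setT (fun z : measurableTypeR R * T => X z.2).
    exact: measurableT_comp.
  have m1 : measurable_fun setT (fun z : measurableTypeR R * T => (z.1 : R)).
    exact: measurable_fst.
  rewrite -[A]setTI (_ : A = (fun z => (z.1 < X z.2)%R) @^-1` [set true])//.
  exact: measurable_fun_ltr.
have iA w : \int[lebesgue_measure]_(r in D) (\1_A (r, w))%:E = (X w)%:E.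
  transitivity (\int[lebesgue_measure]_(r in D)
      (\1_(`[0%R, X w[%classic : set (measurableTypeR R)) r)%:E).
    apply: eq_integral => r; rewrite inE /D/= in_itv/= andbT => r0.
    rewrite !indicE; congr (_%:R%:E); congr nat_of_bool.
    by apply/idP/idP; rewrite !inE /A/= in_itv/= r0.
  rewrite integral_indic//.
  rewrite setIidl; last first.
    by move=> r; rewrite /D/= !in_itv/= => /andP[-> _].
  apply: (eq_trans (lebesgue_measure_itv `[0%R, X w[)); rewrite /= lte_fin.
  by case: ltgtP (X0 w) => //[_ _|<- _]; rewrite ?oppr0 ?adde0 ?sube0.
have m1A : measurable_fun setT (fun z => (\1_A z)%:E : \bar R).
  by apply/measurable_EFinP; exact: measurable_indic.
have mYs : measurable_fun setT (fun z : measurableTypeR R * T => (Y z.2)%:E).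
  by apply/measurable_EFinP; exact: (measurableT_comp mY).
have mXr r : measurable [set w | (r < X w)%R].
  rewrite -[X in measurable X]setTI.
  rewrite (_ : [set w | (r < X w)%R] = (fun w => (r < X w)%R) @^-1` [set true])//.
  exact: measurable_fun_ltr.
have iAE r : \int[P]_w (\1_A (r, w))%:E = P [set w | (r < X w)%R].
  rewrite -[X in P X]setIT -integral_indic//; exact: mXr.
have EX : \int[P]_w (X w)%:E = \int[lebesgue_measure]_(r in D) P [set w | (r < X w)%R].
  under eq_integral do rewrite -iA.
  rewrite -(@fubini_tonelli_on _ _ (measurableTypeR R) T R lebesgue_measure P D mD
    (fun z => (\1_A z)%:E))//.
  - by apply: eq_integral => r _; rewrite iAE.
  - exact: measurable_funTS.
transitivity (\int[P]_w \int[lebesgue_measure]_(r in D) ((\1_A (r, w))%:E * (Y w)%:E)).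
  apply: eq_integral => w _; rewrite ge0_integralZr ?lee_fin//.
  - by rewrite iA.
  - by apply: (@measurable_fun_section1 _ _ _ T R D mD (fun z => (\1_A z)%:E));
      exact: measurable_funTS.
rewrite -(@fubini_tonelli_on _ _ (measurableTypeR R) T R lebesgue_measure P D mD
    (fun z => (\1_A z)%:E * (Y z.2)%:E))//; last 2 first.
- by apply: measurable_funTS; exact: emeasurable_funM.
- by move=> *; rewrite mule_ge0 ?lee_fin.
rewrite EX -ge0_integralZr//.
  apply: (@eq_integral _ _ _ lebesgue_measure D) => r _; rewrite -tails.
  apply: eq_integral => w _; rewrite EFinM !indicE.
  suff -> : ((r, w) \in A) = (w \in [set w | (r < X w)%R]) by [].
  by apply/idP/idP; rewrite !inE.
apply: (eq_measurable_fun (fun r => \int[P]_w (\1_A (r, w))%:E)).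
  by move=> r _; exact: iAE.
apply: (measurable_integral_section P mD (f := fun z => (\1_A z)%:E)) => //.
exact: measurable_funTS.
Qed.

(** [G i] stands for the events of the i-th process, so that [X i] may involve that process at
    several times. *)
Lemma integral_prod_indep (G : nat -> set (set T)) (X : nat -> T -> R) (J : seq nat) :
  (forall i E, G i E -> measurable E) ->
  (forall (J : seq nat) (E : nat -> set T), uniq J ->
    (forall i, i \in J -> G i (E i)) ->
    P (\big[setI/setT]_(i <- J) E i) = \prod_(i <- J) P (E i)) ->
  (forall i, measurable_fun setT (X i)) ->
  (forall i w, (0 <= X i w)%R) ->
  (forall i r, G i [set w | (r < X i w)%R]) ->
  uniq J ->
  \int[P]_w (\prod_(i <- J) X i w)%:E = \prod_(i <- J) \int[P]_w (X i w)%:E.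
Proof.
move=> mG indep mX X0 GX uJ.
(* Generalized to a mixture: the factors in [J2] are already indicators. With [J1] empty this is
   independence of events; the induction turns one factor into its tail indicators and moves its
   index to [J2]. *)
suff gen (J1 J2 : seq nat) (E : nat -> set T) : uniq (J1 ++ J2) ->
    (forall i, i \in J2 -> G i (E i)) ->
    \int[P]_w ((\prod_(i <- J1) X i w) * (\prod_(i <- J2) \1_(E i) w))%:E =
    (\prod_(i <- J1) \int[P]_w (X i w)%:E) * (\prod_(i <- J2) P (E i)).
  have := gen J [::] (fun=> setT); rewrite cats0 => /(_ uJ).
  by rewrite big_nil mule1 => <- //; under [in RHS]eq_integral do rewrite big_nil mulr1.
elim: J1 J2 E => [|j J1 IH] J2 E /= uJ12 GE.
  rewrite big_nil mul1e -indep// -[X in _ = P X]setIT -integral_indic//; last first.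
    by rewrite big_seq; apply: bigsetI_measurable => i /GE /mG.
  apply: eq_integral => w _; rewrite big_nil mul1r; congr EFin.
  elim: J2 {uJ12 GE} => [|i J2 IH]; first by rewrite !big_nil indicT.
  by rewrite !big_cons indicI IH.
have [/andP[jJ uJ']] := (uJ12, uJ12).
rewrite mem_cat negb_or in jJ; have /andP[jJ1 jJ2] := jJ => _.
rewrite !big_cons -muleA.
pose Y w := ((\prod_(i <- J1) X i w) * (\prod_(i <- J2) \1_(E i) w))%R.
transitivity (\int[P]_w (X j w * Y w)%:E).
  by apply: eq_integral => w _; rewrite big_cons mulrA.
rewrite (@integral_mul_of_tails (X j) Y
  (\prod_(i <- J1) \int[P]_w (X i w)%:E * \prod_(i <- J2) P (E i)))//.
- apply: measurable_funM; apply: measurable_prod => i iJ //.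
  by apply: measurable_indic; exact: (mG _ _ (GE _ iJ)).
- by move=> w; rewrite mulr_ge0// prodr_ge0.
- by rewrite mule_ge0// prode_ge0// => i _; rewrite integral_ge0// => w _; rewrite lee_fin.
- move=> r.
  pose E' i := if i == j then [set w | (r < X j w)%R] else E i.
  have E'E w : (\prod_(i <- J2) \1_(E' i) w = \prod_(i <- J2) \1_(E i) w :> R)%R.
    by rewrite !big_seq; apply: eq_bigr => i iJ2; rewrite /E'; case: eqP iJ2 jJ2 => // -> ->.
  have PE'E : \prod_(i <- J2) P (E' i) = \prod_(i <- J2) P (E i).
    by rewrite !big_seq; apply: eq_bigr => i iJ2; rewrite /E'; case: eqP iJ2 jJ2 => // -> ->.
  have E'j : E' j = [set w | (r < X j w)%R] by rewrite /E' eqxx.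
  have := IH (j :: J2) E'; rewrite big_cons PE'E E'j muleCA => <-.
  + apply: eq_integral => w _; rewrite big_cons E'E E'j /Y.
    by rewrite mulrCA.
  + by rewrite -cat1s uniq_catCA.
  + by move=> i; rewrite inE /E'; case: eqP => [-> _|_ /= /GE].
Qed.

End independence.

(** * Moments depend only on finite-dimensional laws *)

Section finite_dimensional_distributions.
Local Open Scope ereal_scope.
Context d (T : measurableType d) d' (T' : measurableType d') (R : realType).
Variables (P : probability T R) (P' : probability T' R).
Variables (X : R -> T -> R) (X' : R -> T' -> R).
Hypothesis mX : forall t, (0 <= t)%R -> measurable_fun setT (X t).
Hypothesis mX' : forall t, (0 <= t)%R -> measurable_fun setT (X' t).
Hypothesis XX' : same_fdd P P' X X'.

Lemma same_fdd_integral n (t : n.-tuple R)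
    (g : n.-tuple (measurableTypeR R) -> \bar R) :
  (forall k, (0 <= tnth t k)%R) -> measurable_fun setT g -> (forall x, 0 <= g x) ->
  \int[P]_w g [tuple X (tnth t k) w | k < n] =
  \int[P']_w g [tuple X' (tnth t k) w | k < n].
Proof.
move=> t0 mg g0.
have mphi e (U : measurableType e) (Y : R -> U -> R) :
    (forall t, (0 <= t)%R -> measurable_fun setT (Y t)) ->
    measurable_fun setT (fun w => [tuple Y (tnth t k) w | k < n] : n.-tuple (measurableTypeR R)).
  move=> mY; apply/measurable_fun_tnthP => i.
  rewrite (_ : _ \o _ = Y (tnth t i)); first exact: mY.
  by apply/funext => w /=; rewrite tnth_mktuple.
(* Both sides become integrals of [g] against image measures on n-tuples, which [XX'] identifies. *)
have := ge0_integral_pushforward (mphi _ _ _ mX) P measurableT mg (fun x _ => g0 x).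
have := ge0_integral_pushforward (mphi _ _ _ mX') P' measurableT mg (fun x _ => g0 x).
rewrite !preimage_setT => <- <-.
apply: eq_measure_integral; [exact: mphi|exact: mphi|move=> ? ? A mA _].
exact: XX'.
Qed.

Lemma same_fdd_integral1 (s : R) (h : R -> R) : (0 <= s)%R ->
  measurable_fun setT h -> (forall x, (0 <= h x)%R) ->
  \int[P]_w (h (X s w))%:E = \int[P']_w (h (X' s w))%:E.
Proof.
move=> s0 mh h0.
pose g (x : 1.-tuple (measurableTypeR R)) := (h (tnth x ord0))%:E.
transitivity (\int[P]_w g [tuple X (tnth [tuple s] k) w | k < 1]).
  by apply: eq_integral => w _; rewrite /g tnth_mktuple.
rewrite same_fdd_integral; last 3 first.
- by move=> k; rewrite (ord1 k).
- apply/measurable_EFinP; apply: measurableT_comp => //; exact: measurable_tnth.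
- by move=> x; rewrite lee_fin.
by apply: eq_integral => w _; rewrite /g tnth_mktuple.
Qed.

Lemma same_fdd_integral_norm_mul (s u : R) : (0 <= s)%R -> (0 <= u)%R ->
  \int[P]_w (`|X s w| * `|X u w|)%:E = \int[P']_w (`|X' s w| * `|X' u w|)%:E.
Proof.
move=> s0 u0.
pose g (x : 2.-tuple (measurableTypeR R)) : \bar R :=
  (`|tnth x ord0 : R| * `|tnth x (lift ord0 ord0) : R|)%:E.
transitivity (\int[P]_w g [tuple X (tnth [tuple s; u] k) w | k < 2]).
  by apply: eq_integral => w _; rewrite /g !tnth_mktuple.
rewrite same_fdd_integral; last 3 first.
- by move=> k; case: (unliftP ord0 k) => [j ->|->]; rewrite ?(ord1 j).
- by apply/measurable_EFinP/measurable_funM;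
    apply: measurableT_comp => //; exact: measurable_tnth.
- by move=> x; rewrite lee_fin.
by apply: eq_integral => w _; rewrite /g !tnth_mktuple.
Qed.

End finite_dimensional_distributions.

(** * Moments of a mother process *)

Section processes.
Local Open Scope ereal_scope.
Context d (T : measurableType d) (R : realType) (P : probability T R).
Implicit Type X : R -> T -> R.

Lemma measurable_process_section X t : measurable_process X -> (0 <= t)%R ->
  measurable_fun setT (X t).
Proof.
move=> mX t0.
have mD : measurable (`[0%R, +oo[%classic : set (measurableTypeR R)) by exact: measurable_itv.
apply: (@measurable_comp _ _ _ T (measurableTypeR R * T)%type R
  (`[0%R, +oo[ `*` [set: T]) (fun z => X z.1 z.2) setT (fun w => (t, w))) => //.
- exact: measurableX.
- by move=> _ [w _ <-]; split => //=; rewrite in_itv/= t0.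
- exact: measurable_pair1.
Qed.

Lemma autocorrelationE X u : mother_process P X -> (0 <= u)%R ->
  \int[P]_w (`|X 0%R w| * `|X u w|)%:E = autocorrelation P X u.
Proof.
move=> mX u0; rewrite /autocorrelation unlock.
have mXt t := measurable_process_section (mother_measurable mX) (t := t).
apply: ae_eq_integral => //.
- by apply/measurable_EFinP/measurable_funM; apply: measurableT_comp => //; exact: mXt.
- by apply/measurable_EFinP/measurable_funM; exact: mXt.
- have := mother_positive mX (lexx 0%R); apply: filterS2 (mother_positive mX u0).
  by move=> w Xu X0 _; rewrite !gtr0_norm.
Qed.

Lemma mother_norm_mul X s u : mother_process P X -> (0 <= s)%R -> (0 <= u)%R ->
  \int[P]_w (`|X s w| * `|X u w|)%:E = autocorrelation P X `|s - u|%R.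
Proof.
move=> mX; wlog su : s u / (s <= u)%R.
  move=> H s0 u0; have [su|/ltW us] := leP s u; first exact: H.
  under eq_integral do rewrite mulrC.
  by rewrite H// distrC.
move=> s0 u0; rewrite distrC ger0_norm ?subr_ge0// -autocorrelationE ?subr_ge0//.
have mXt t := measurable_process_section (mother_measurable mX) (t := t).
(* Stationarity with shift [s], the smaller time, sends the pair (0, u - s) to (s, u). *)
have := @same_fdd_integral_norm_mul _ _ _ _ _ P P (fun t => X (t + s)%R) X _ _ _ 0%R (u - s)%R.
rewrite /= add0r subrK => <- //; last by rewrite subr_ge0.
- by move=> t t0; apply: mXt; rewrite addr_ge0.
- exact: mother_stationary.
Qed.

(** Encodes a.e. nonnegativity as an integral determined by a one-dimensional law, a form that
    passes to any process with the same laws. *)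
Lemma mother_neg_part X s : mother_process P X -> (0 <= s)%R ->
  \int[P]_w (Num.max (- X s w) 0)%:E = 0.
Proof.
move=> mX s0; rewrite (ae_eq_integral (cst 0)) ?integral0//.
- apply/measurable_EFinP; apply: measurable_maxr => //.
  by apply: measurableT_comp => //; exact: measurable_process_section (mother_measurable mX) s0.
- apply: filterS (mother_positive mX s0) => w Xs _ /=.
  by congr EFin; apply/max_idPr; rewrite lerNl oppr0 ltW.
Qed.

Lemma mother_norm X s : mother_process P X -> (0 <= s)%R ->
  \int[P]_w (`|X s w|)%:E = 1.
Proof.
move=> mX s0; rewrite -(mother_mean mX s0) unlock.
have mXs := measurable_process_section (mother_measurable mX) s0.
apply: ae_eq_integral => //.
- by apply/measurable_EFinP; exact: measurableT_comp.
- exact/measurable_EFinP.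
- by apply: filterS (mother_positive mX s0) => w Xs _; rewrite gtr0_norm.
Qed.

End processes.

(** A nonnegative integral is a supremum over the simple functions below the integrand, which is
    monotone for arbitrary integrands. Integrals of the kernel can thus be bounded without proving
    its measurability. *)
Lemma ge0_le_integral_any d (T : measurableType d) (R : realType)
    (mu : {measure set T -> \bar R}) (D : set T) (f g : T -> \bar R) :
  (forall x, D x -> 0 <= f x)%E -> (forall x, D x -> f x <= g x)%E ->
  (\int[mu]_(x in D) f x <= \int[mu]_(x in D) g x)%E.
Proof.
move=> f0 fg; have g0 x : D x -> (0 <= g x)%E.
  by move=> Dx; exact: le_trans (f0 _ Dx) (fg _ Dx).
rewrite !ge0_integralE//; apply: ereal_sup_le => _ [h hf <-]; exists h => //= x.
by apply: le_trans (hf x) _; exact: lee_restrict.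
Qed.

(** * The autocorrelation is at least 1 *)

Section autocorrelation_lower_bound.
Local Open Scope ereal_scope.
Context d (T : measurableType d) (R : realType) (P : probability T R).

(* If r u < 1, the n variables X(iu), i < n, would have pairwise covariances at
   most r u - 1 < 0, and for large n their sum would have negative variance. *)
Lemma autocorrelation_ge1 (X : R -> T -> R) (r : R -> R) : mother_process P X ->
  (forall u : R, (0 <= u)%R -> autocorrelation P X u = (r u)%:E) ->
  (forall u v : R, 0 <= u -> u <= v -> r v <= r u)%R ->
  forall u : R, (0 <= u -> 1 <= r u)%R.
Proof.
move=> mX rE r_le u u0.
have mXt t := measurable_process_section (mother_measurable mX) (t := t).
have r_ge0 v : (0 <= v)%R -> (0 <= r v)%R.
  move=> v0; rewrite -lee_fin -rE// -autocorrelationE//; apply: integral_ge0 => w _.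
  by rewrite lee_fin.
have t0 (i : nat) : (0 <= i%:R * u)%R by rewrite mulr_ge0.
(* This is (E S)^2 <= E S^2 for the sum of n variables, with the diagonal generously counted in both
   terms. Dividing by n gives n (1 - r u) <= r 0, which fails for large n if r u < 1. *)
suff main (n : nat) : (n%:R * n%:R <= n%:R * n%:R * r u + n%:R * r 0)%R.
  rewrite leNgt; apply/negP => r1.
  have r1' : (0 < 1 - r u)%R by rewrite subr_gt0.
  pose n := (Num.truncn (r 0 / (1 - r u))%R).+1.
  have n0 : (0 < n%:R :> R)%R by rewrite ltr0n.
  have : (r 0 / (1 - r u) < n%:R)%R by exact: truncnS_gt.
  rewrite ltr_pdivrMr//.
  have := main n; rewrite -mulrA -mulrDr ler_pM2l// => h; lra.
pose S w := (\sum_(i < n) `|X (i%:R * u) w|)%R.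
have mS : measurable_fun setT S.
  by apply: measurable_sum => i; apply: measurableT_comp => //; exact: mXt.
have ES : \int[P]_w (S w)%:E = n%:R%:E.
  under eq_integral do rewrite -sumEFin.
  rewrite ge0_integral_sum//; last first.
    by move=> i; apply/measurable_EFinP; apply: measurableT_comp => //; exact: mXt.
  under eq_bigr do rewrite mother_norm//.
  by rewrite sumEFin sumr_const card_ord.
have ES2 : \int[P]_w (S w ^+ 2)%:E <= (n%:R * n%:R * r u + n%:R * r 0)%:E.
  have -> : \int[P]_w (S w ^+ 2)%:E =
      \sum_(i < n) \sum_(j < n) \int[P]_w (`|X (i%:R * u) w| * `|X (j%:R * u) w|)%:E.
    under eq_integral do rewrite expr2 /S big_distrlr/= -sumEFin.
    have mXX (i j : 'I_n) : measurable_fun setT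
        (fun w => (`|X (i%:R * u)%R w| * `|X (j%:R * u)%R w|)%:E).
      by apply/measurable_EFinP/measurable_funM; apply: measurableT_comp => //; exact: mXt.
    under eq_integral do under eq_bigr do rewrite -sumEFin.
    rewrite ge0_integral_sum//; last 2 first.
    - by move=> i; exact: emeasurable_sum.
    - by move=> i w _; apply: sume_ge0 => j _; rewrite lee_fin.
    by apply: eq_bigr => i _; rewrite ge0_integral_sum.
  apply: (@le_trans _ _ (\sum_(i < n) \sum_(j < n) (r u + (j == i)%:R * r 0)%:E)).
    apply: lee_sum => i _; apply: lee_sum => j _.
    rewrite mother_norm_mul// rE// lee_fin.
    have [->|ij] := eqVneq j i.
      by rewrite subrr normr0 mul1r lerDr r_ge0.
    (* Distinct indices are at least 1 apart, so the time lag is at least [u] and monotonicity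
       applies. *)
    rewrite mul0r addr0 r_le// -mulrBl normrM (ger0_norm u0) ler_peMl//.
    have [k|k|/ord_inj k] := ltngtP j i.
    - by rewrite -natrB ?(ltnW k)// ger0_norm// ler1n subn_gt0.
    - by rewrite distrC -natrB ?(ltnW k)// ger0_norm// ler1n subn_gt0.
    - by rewrite k eqxx in ij.
  under eq_bigr do rewrite sumEFin.
  rewrite sumEFin lee_fin le_eqVlt; apply/orP; left; apply/eqP.
  under eq_bigr => i _.
    rewrite big_split/= sumr_const card_ord -mulr_suml (bigD1 i)//= eqxx big1; last first.
      by move=> j /negbTE ->.
    over.
  by rewrite sumr_const card_ord addr0 mul1r -(mulr_natl (_ + _))
    -(mulr_natl (r u)) mulrDr mulrA.
rewrite -lee_fin.
(* Integrating 2 n S <= n^2 + S^2 with E S = n yields n^2 <= E S^2. *)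
have : \int[P]_w (n%:R * 2 * S w)%:E <= \int[P]_w (n%:R * n%:R + 1 * S w ^+ 2)%:E.
  apply: ge0_le_integral_any => w _; rewrite lee_fin.
    by rewrite !mulr_ge0// sumr_ge0.
  rewrite -subr_ge0 (_ : _ - _ = (S w - n%:R) ^+ 2)%R ?sqr_ge0//.
  by move: (S w) n%:R => s N; ring.
rewrite integral_affine_sqr ?mulr_ge0// mul1e.
under eq_integral do rewrite EFinM.
rewrite ge0_integralZl//; last 2 first.
- exact/measurable_EFinP.
- by move=> w _; rewrite lee_fin sumr_ge0.
rewrite ES => h; have := le_trans h (leeD2l _ ES2).
rewrite -EFinM -EFinD !lee_fin.
by move: n%:R (r u) (r 0%R) => N ru r0 ?; lra.
Qed.

End autocorrelation_lower_bound.

(** * Bounds on the kernel and its double integral *)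

Section cascade_kernel.
Context (R : realType) (r : R -> R) (b C : R).
Hypothesis b1 : 1 < b.
Hypothesis r_ge1 : forall u : R, 0 <= u -> 1 <= r u.
Hypothesis r_le : forall u v : R, 0 <= u -> u <= v -> r v <= r u.
Hypothesis prod_le : forall n, \prod_(i < n) r (b ^+ i) <= C.

Let r0 := r 0.
Let r0_ge1 : 1 <= r0. Proof. exact: r_ge1. Qed.
Let b0 : 0 < b. Proof. exact: lt_trans b1. Qed.
Let C1 : 1 <= C. Proof. by have := prod_le 0; rewrite big_ord0. Qed.

(** Induction by scale. If v >= 1, monotonicity compares each factor with r(b^i). Otherwise the
    first factor is at most r(0), and the rest is the same product at v b. A sum of indicators is
    used because it can be integrated term by term. *)
Lemma prod_scaled_le n (v : R) : 0 <= v ->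
  \prod_(i < n) r (v * b ^+ i) <=
  C * (1 + \sum_(k < n) r0 ^+ k.+1 * (v < b ^- k)%R%:R).
Proof.
have r00 : 0 <= r0 by exact: le_trans r0_ge1.
have C0 : 0 <= C by exact: le_trans C1.
have sum_ge0 m x : 0 <= \sum_(k < m) r0 ^+ k.+1 * (x < b ^- k)%R%:R :> R.
  by apply: sumr_ge0 => k _; rewrite mulr_ge0// exprn_ge0.
elim: n v => [|n IH] v v0; first by rewrite !big_ord0 addr0 mulr1.
have [v1|v1] := leP 1 v.
  apply: (@le_trans _ _ C); last by rewrite ler_peMr// lerDl.
  apply: le_trans (prod_le n.+1); apply: ler_prod => i _.
  have bi : 0 <= b ^+ i by rewrite exprn_ge0// ltW.
  rewrite (le_trans ler01 (r_ge1 _)) ?mulr_ge0//=.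
  by apply: r_le => //; rewrite ler_peMl.
rewrite big_ord_recl expr0 mulr1.
under eq_bigr do rewrite /= /bump/= exprS mulrA.
have vb0 : 0 <= v * b by rewrite mulr_ge0// ltW.
apply: (@le_trans _ _ (r0 * (C * (1 + \sum_(k < n) r0 ^+ k.+1 * (v * b < b ^- k)%R%:R)))).
  apply: ler_pM => //; first exact: le_trans (r_ge1 v0).
  - by apply: prodr_ge0 => i _; apply: le_trans (r_ge1 _) => //;
      rewrite mulr_ge0// exprn_ge0// ltW.
  - exact: r_le.
  - exact: IH.
(* Since v < 1, the term k = 0 equals r(0) and absorbs the new constant; the other terms are those
   for v b, shifted by one. *)
rewrite mulrCA ler_wpM2l// big_ord_recl/= expr0 invr1 v1 expr1 mulr1 mulrDr mulr1.
apply: (@le_trans _ _ (r0 + \sum_(i < n) r0 ^+ (bump 0 i).+1 * (v < b ^- bump 0 i)%R%:R));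
  last by rewrite lerDr.
rewrite lerD2l mulr_sumr ler_sum// => k _.
have -> : (v * b < b ^- k) = (v < b ^- k.+1).
  by rewrite -ltr_pdivlMr// exprS invfM mulrC.
by rewrite mulrA -exprS /bump/= !add1n.
Qed.

Lemma prod_scaled_ge0 n (v : R) : 0 <= v -> 0 <= \prod_(i < n) r (v * b ^+ i).
Proof.
move=> v0; apply: prodr_ge0 => i _; apply: le_trans ler01 (r_ge1 _).
by rewrite mulr_ge0// exprn_ge0// ltW.
Qed.

(** The inner integral is bounded uniformly in [s], so the outer one costs at most the length t <=
    1. The exponent k + 1 in [prod_scaled_le] produces the factor r(0) before the geometric
    series. *)
Lemma integral_prod_scaled_le (t : R) n : r0 < b -> 0 <= t <= 1 ->
  (\int[lebesgue_measure]_(s in `[0%R, t]) \int[lebesgue_measure]_(u in `[0%R, t])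
     (\prod_(i < n) r (`|s - u| * b ^+ i))%:E <=
   (C * (1 + 2 * r0 / (1 - r0 / b)))%:E)%E.
Proof.
move=> r0b /andP[t0 t1].
have r00 : 0 <= r0 by exact: le_trans r0_ge1.
have C0 : 0 <= C by exact: le_trans C1.
have D1 : (lebesgue_measure (`[0%R, t]%classic : set R) <= 1%:E)%E.
  by rewrite lebesgue_measure_itv/= lte_fin; case: ifP => _; rewrite ?oppr0 ?adde0 lee_fin.
pose ball_ (s c : R) : set R := `]s - c, s + c[%classic.
have ballE (s c u : R) : (`|s - u| < c)%R%:R = \1_(ball_ s c) u :> R.
  rewrite indicE; congr (_%:R); congr nat_of_bool.
  by apply/idP/idP; rewrite inE /ball_/= in_itv/= ltr_distlC.
have strip (s c : R) : 0 <= c ->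
    (\int[lebesgue_measure]_(u in `[0%R, t]) (\1_(ball_ s c) u : R)%:E <= (2 * c)%:E)%E.
  move=> c0; rewrite integral_indic//; try exact: measurable_itv.
  apply: (@le_trans _ _ (lebesgue_measure (ball_ s c))).
    by apply: le_measure; rewrite ?inE; [apply: measurableI|..]; try exact: measurable_itv.
  rewrite lebesgue_measure_itv/= lte_fin; case: ifP => _; last by rewrite lee_fin mulr_ge0.
  by rewrite -EFinD lee_fin; lra.
have geo : \sum_(k < n) r0 ^+ k.+1 * (2 * b ^- k) <= 2 * r0 / (1 - r0 / b).
  pose q := r0 / b.
  have q0 : 0 <= q by rewrite divr_ge0// ltW.
  have q1 : 0 < 1 - q by rewrite subr_gt0 ltr_pdivrMr// mul1r.
  rewrite (eq_bigr (fun k : 'I_n => 2 * r0 * q ^+ k)); last first.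
    by move=> k _; rewrite exprMn exprVn exprS; ring.
  rewrite -mulr_sumr ler_pdivlMr// -[leLHS]mulrA ler_piMr ?mulr_ge0//.
  have := subrX1 q n; rewrite -opprB -[in RHS]opprB mulNr => /oppr_inj.
  by rewrite mulrC => <-; rewrite lerBlDr lerDl exprn_ge0.
set M := C * _.
have inner s : (\int[lebesgue_measure]_(u in `[0%R, t])
     (\prod_(i < n) r (`|s - u| * b ^+ i))%:E <= M%:E)%E.
  apply: (@le_trans _ _ (\int[lebesgue_measure]_(u in `[0%R, t])
     (C%:E * (1 + \sum_(k < n) (r0 ^+ k.+1)%:E * (\1_(ball_ s (b ^- k)) u : R)%:E)))%E).
    apply: ge0_le_integral_any => u _; first by rewrite lee_fin prod_scaled_ge0.
    under [X in (_ <= _ * (_ + X))%E]eq_bigr do rewrite -ballE -EFinM.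
    by rewrite sumEFin -EFinD -EFinM lee_fin; exact: prod_scaled_le.
  have mb k : measurable_fun `[0%R, t]
      (fun u => (r0 ^+ k.+1)%:E * (\1_(ball_ s (b ^- k)) u : R)%:E)%E.
    apply: emeasurable_funM => //; apply/measurable_EFinP/measurable_indic.
    exact: measurable_itv.
  have b_ge0 k u : (0 <= (r0 ^+ k.+1)%:E * (\1_(ball_ s (b ^- k)) u : R)%:E)%E.
    by rewrite mule_ge0 ?lee_fin// exprn_ge0.
  rewrite ge0_integralZl//; last 2 first.
  - by apply: emeasurable_funD => //; apply: emeasurable_sum => k; exact: mb.
  - by move=> u _; rewrite adde_ge0// sume_ge0.
  rewrite /M EFinM; apply: lee_wpmul2l; first by rewrite lee_fin.
  rewrite ge0_integralD//; last 2 first.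
  - by move=> u _; rewrite sume_ge0.
  - apply: emeasurable_sum => k; exact: mb.
  rewrite integral_cst// mul1e EFinD; apply: leeD => //.
  rewrite ge0_integral_sum//; last by move=> k; exact: mb.
  apply: (@le_trans _ _ (\sum_(k < n) (r0 ^+ k.+1 * (2 * b ^- k))%:E)%E); last first.
    by rewrite sumEFin lee_fin.
  apply: lee_sum => k _; rewrite ge0_integralZl//; last 2 first.
  - by apply/measurable_EFinP/measurable_indic; exact: measurable_itv.
  - by rewrite lee_fin exprn_ge0.
  rewrite [leRHS]EFinM; apply: lee_wpmul2l; first by rewrite lee_fin exprn_ge0.
  by apply: strip; rewrite invr_ge0 exprn_ge0// ltW.
apply: (@le_trans _ _ (\int[lebesgue_measure]_(s in `[0%R, t]) cst M%:E s)%E).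
  apply: ge0_le_integral_any => s _ //.
  by apply: integral_ge0 => u _; rewrite lee_fin prod_scaled_ge0.
have M0 : 0 <= M.
  by rewrite mulr_ge0// addr_ge0// divr_ge0 ?mulr_ge0// subr_ge0 ler_pdivrMr// mul1r ltW.
rewrite integral_cst//= -[leRHS]mule1; exact: lee_wpmul2l.
Qed.

End cascade_kernel.

(** * Bounded second moments with martingale-type mixed moments *)

Section square_integrable_martingale.
Local Open Scope ereal_scope.
Context d (T : measurableType d) (R : realType) (P : probability T R).
Variables (X : nat -> T -> R) (k : nat -> R) (M : R).
Hypothesis mX : forall n, measurable_fun setT (X n).
Hypothesis X0 : forall n w, (0 <= X n w)%R.
Hypothesis XX : forall m n, (m <= n)%N -> \int[P]_w (X m w * X n w)%:E = (k m)%:E.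
Hypothesis kM : forall n, (k n <= M)%R.

Lemma integral_sqr_sub m n : (m <= n)%N ->
  \int[P]_w ((X n w - X m w) ^+ 2)%:E = (k n - k m)%:E.
Proof.
move=> mn.
have mXX i j : measurable_fun setT (fun w => (X i w * X j w)%:E).
  by apply/measurable_EFinP; exact: measurable_funM.
have XX0 i j w : 0 <= (X i w * X j w)%:E by rewrite lee_fin mulr_ge0.
have mD : measurable_fun setT (fun w => ((X n w - X m w) ^+ 2)%:E).
  by apply/measurable_EFinP/measurable_funX; exact: measurable_funB.
have D0 w : 0 <= ((X n w - X m w) ^+ 2)%:E by rewrite lee_fin sqr_ge0.
(* The expanded square is arranged with nonnegative terms on both sides, so additivity applies
   before the first integral is known to be finite. *)
have : \int[P]_w (((X n w - X m w) ^+ 2)%:E + ((X m w * X n w)%:E + (X m w * X n w)%:E))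
     = \int[P]_w ((X n w * X n w)%:E + (X m w * X m w)%:E).
  by apply: eq_integral => w _; rewrite -!EFinD; congr EFin; ring.
rewrite !ge0_integralD//; last 2 first.
- by move=> w _; rewrite adde_ge0.
- exact: emeasurable_funD.
rewrite !XX//.
have : 0 <= \int[P]_w ((X n w - X m w) ^+ 2)%:E by exact: integral_ge0.
case: (\int[P]_w ((X n w - X m w) ^+ 2)%:E) => //= a _.
by rewrite -!EFinD => -[?]; congr EFin; lra.
Qed.

(** By [integral_sqr_sub], [k] is nondecreasing; being bounded, it comes within [e] of its supremum
    at some [N]. *)
Lemma square_integrable_martingale_cauchy (e : R) : (0 < e)%R -> exists N,
  forall m n, (N <= m)%N -> (N <= n)%N -> \int[P]_w ((X n w - X m w) ^+ 2)%:E <= e%:E.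
Proof.
move=> e0.
have k_nd m n : (m <= n)%N -> (k m <= k n)%R.
  move=> mn; rewrite -subr_ge0 -lee_fin -integral_sqr_sub//.
  by apply: integral_ge0 => w _; rewrite lee_fin sqr_ge0.
have hs : has_sup (range k).
  by split; [exists (k 0%N), 0%N|exists M => _ [n _ <-]].
have [_ [N _ <-] kN] := sup_adherent e0 hs.
have k_sup n : (k n <= sup (range k))%R by apply: sup_ubound; [exact: hs.2|exists n].
have main m n : (N <= m)%N -> (m <= n)%N -> \int[P]_w ((X n w - X m w) ^+ 2)%:E <= e%:E.
  move=> Nm mn; rewrite integral_sqr_sub// lee_fin.
  have := k_sup n; have := k_nd _ _ Nm; move: kN; lra.
exists N => m n Nm Nn; have [mn|/ltnW nm] := leqP m n; first exact: main.
by under eq_integral do rewrite -sqrrN opprB; exact: main.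
Qed.

End square_integrable_martingale.

(** * The cumulative processes and their limit *)

Section cumulative.
Local Open Scope ereal_scope.
Context d (T : measurableType d) (R : realType) (P : probability T R).
Variables (Y : nat -> R -> T -> R) (t : R).
Hypothesis mY : forall i, measurable_process (Y i).
Hypothesis Yindep : independent_processes P Y.

Let D : set (measurableTypeR R) := `[0%R, t]%classic.
Let mD : measurable D. Proof. exact: measurable_itv. Qed.
Let D_ge0 s : D s -> (0 <= s)%R. Proof. by rewrite /D/= in_itv/= => /andP[]. Qed.

Let mYt i s : (0 <= s)%R -> measurable_fun setT (Y i s).
Proof. exact: measurable_process_section. Qed.

Lemma process_sigma_measurable i E : process_sigma (Y i) E -> measurable E.
Proof.
apply: smallest_sub; first exact: sigma_algebra_measurable.
by move=> _ [s [B [s0 mB ->]]]; rewrite -[X in measurable X]setTI; exact: mYt.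
Qed.

(** Supplies the tail events that [integral_prod_indep] asks for, for the two kinds of factors met
    below. Measurability is taken with respect to the sigma-algebra generated by the process
    itself. *)
Lemma process_sigma_norm_mul i s u c : (0 <= s)%R -> (0 <= u)%R ->
  process_sigma (Y i) [set w | (c < `|Y i s w| * `|Y i u w|)%R] /\
  process_sigma (Y i) [set w | (c < `|Y i u w|)%R].
Proof.
move=> s0 u0.
set G := [set E | exists (t : R) (B : set R),
         [/\ (0 <= t)%R, measurable B & E = Y i t @^-1` B]].
have mG v : (0 <= v)%R ->
    measurable_fun [set: g_sigma_algebraType G] (fun w => `|Y i v w|)%R.
  move=> v0; apply: measurableT_comp => // _ B mB; rewrite setTI.
  by apply: sub_sigma_algebra; exists v, B.
have gt_mG (f : T -> R) : measurable_fun [set: g_sigma_algebraType G] f ->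
    process_sigma (Y i) [set w | (c < f w)%R].
  move=> mf; have := mf measurableT `]c, +oo[%classic (measurable_itv _).
  rewrite setTI (_ : _ @^-1` _ = [set w | (c < f w)%R])//.
  by apply/seteqP; split => w /=; rewrite in_itv/= andbT.
split; apply: gt_mG; last exact: mG.
by apply: measurable_funM; exact: mG.
Qed.

Lemma measurable_product_process n :
  measurable_fun (D `*` [set: T]) (fun z => product_process Y n z.1 z.2).
Proof.
apply: measurable_prod => i _.
apply: measurable_funS (mY i).
- by apply: measurableX => //; exact: measurable_itv.
- by move=> z [/D_ge0 z0 _]; split => //=; rewrite in_itv/= z0.
Qed.

Variables (r : R -> R) (b : R).
Hypothesis EY : forall i s, (0 <= s)%R -> \int[P]_w `|Y i s w|%:E = 1.
Hypothesis EYY : forall i s u, (0 <= s)%R -> (0 <= u)%R ->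
  \int[P]_w (`|Y i s w| * `|Y i u w|)%:E = (r (`|s - u| * b ^+ i)%R)%:E.
Hypothesis Y_ge0 : forall i s, (0 <= s)%R -> {ae P, forall w, (0 <= Y i s w)%R}.

Lemma integral_norm_product_process m n s u : (m <= n)%N ->
  (0 <= s)%R -> (0 <= u)%R ->
  \int[P]_w (`|product_process Y m s w| * `|product_process Y n u w|)%:E =
  (\prod_(i < m.+1) r (`|s - u| * b ^+ i))%:E.
Proof.
move=> mn s0 u0.
(* Levels up to [m] occur at both times and contribute [r]; the levels after [m] occur only at time
   [u] and contribute their mean 1. *)
pose f i := if (i < m.+1)%N then (fun w => `|Y i s w| * `|Y i u w|)%R
  else (fun w => `|Y i u w|)%R.
transitivity (\int[P]_w (\prod_(i <- index_iota 0 n.+1) f i w)%:E).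
  apply: eq_integral => w _; congr EFin.
  rewrite /product_process !normr_prod.
  rewrite -(big_mkord xpredT (fun i => `|Y i s w|%R))
    -(big_mkord xpredT (fun i => `|Y i u w|%R)).
  rewrite [X in (_ * X)%R](big_cat_nat _ (n := m.+1))//= mulrA -big_split/=.
  rewrite [RHS](big_cat_nat _ (n := m.+1))//=; congr (_ * _)%R.
    by apply: eq_big_nat => i /andP[_ im]; rewrite /f im.
  by apply: eq_big_nat => i /andP[im _]; rewrite /f ltnNge im.
rewrite (@integral_prod_indep _ _ _ P (fun i => process_sigma (Y i)) f); last 6 first.
- exact: process_sigma_measurable.
- exact: Yindep.
- by move=> i; rewrite /f; case: ifP => _; [apply: measurable_funM|];
    apply: measurableT_comp => //; exact: mYt.
- by move=> i w; rewrite /f; case: ifP => _; rewrite ?mulr_ge0.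
- move=> i c; have [] := process_sigma_norm_mul i c s0 u0.
  by rewrite /f; case: ifP.
- exact: iota_uniq.
rewrite (big_cat_nat _ (n := m.+1))//= [X in _ * X]big1_seq ?mule1; last first.
  move=> i; rewrite mem_index_iota => /andP[_ /andP[im _]].
  by rewrite /f ltnNge im/= EY.
rewrite -prodEFin big_mkord; apply: eq_bigr => i _.
by rewrite /f ltn_ord EYY.
Qed.

(** A version of the cumulative process that is nonnegative at every [w], at the price of possibly
    infinite values. *)
Let B n w := \int[lebesgue_measure]_(s in D) `|product_process Y n s w|%:E.

Let mnorm n : measurable_fun (D `*` [set: T])
  (fun z => `|product_process Y n z.1 z.2|%:E).
Proof.
apply/measurable_EFinP; apply: measurableT_comp => //.
exact: measurable_product_process.
Qed.

Lemma integral_mul_cumulative m n : (m <= n)%N ->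
  \int[P]_w (B m w * B n w) =
  \int[lebesgue_measure]_(s in D) \int[lebesgue_measure]_(u in D)
    (\prod_(i < m.+1) r (`|s - u| * b ^+ i))%:E.
Proof.
move=> mn.
rewrite (integral_mul_integrals_on lebesgue_measure P mD (mnorm m) (mnorm n))//.
apply: eq_integral => s; rewrite inE => /D_ge0 s0.
apply: eq_integral => u; rewrite inE => /D_ge0 u0.
by rewrite -(integral_norm_product_process mn).
Qed.

Let L n (z : measurableTypeR R * T) := (product_process Y n z.1 z.2)%:E.

Let mL n : measurable_fun (D `*` [set: T]) (L n).
Proof. by rewrite /L; apply/measurable_EFinP; exact: measurable_product_process. Qed.

Let cumulativeE n w : cumulative_process Y n t w =
  fine (\int[lebesgue_measure]_(s in D) (L n)^\+ (s, w) -
        \int[lebesgue_measure]_(s in D) (L n)^\- (s, w)).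
Proof.
rewrite /cumulative_process /Rintegral integralE; congr (fine (_ - _)).
  by apply: eq_integral => s _; rewrite !funeposE.
by apply: eq_integral => s _; rewrite !funenegE.
Qed.

Lemma measurable_cumulative_process n :
  measurable_fun setT (cumulative_process Y n t).
Proof.
rewrite (funext (cumulativeE n)).
apply: (measurableT_comp (fine_measurable measurableT)).
apply: emeasurable_funB; apply: measurable_integral_on => //.
- exact: measurable_funepos.
- exact: measurable_funeneg.
Qed.

(** The exceptional set of [Y_ge0] varies with the time, so Tonelli is applied to the negative part:
    its integral over both variables vanishes, hence so does its time integral for a.e. [w]. The two
    extended integrals then coincide, and [fine] agrees on them even if they are infinite. *)
Lemma cumulative_process_ae n :
  {ae P, forall w, cumulative_process Y n t w = fine (B n w)}.
Proof.
have L_ge0 s : (0 <= s)%R -> {ae P, forall w, 0 <= L n (s, w)}.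
  move=> s0.
  suff : {ae P, forall w, (0 <= \prod_(i < n.+1) Y i s w)%R} by [].
  elim: n.+1 => [|m IH]; first by apply: aeW => w; rewrite big_ord0.
  apply: filterS2 IH (Y_ge0 m s0) => w p0 y0.
  by rewrite big_ord_recr mulr_ge0.
have neg0 : \int[P]_w `|\int[lebesgue_measure]_(s in D) (L n)^\- (s, w)| = 0.
  under eq_integral do rewrite gee0_abs ?integral_ge0//.
  rewrite -(fubini_tonelli_on lebesgue_measure P mD (measurable_funeneg (mL n)))//.
  apply: integral0_eq => s Ds; have s0 := D_ge0 Ds.
  rewrite (ae_eq_integral (cst 0)) ?integral0//.
    exact: measurable_fun_section2 Ds (measurable_funeneg (mL n)).
  apply: filterS (L_ge0 s s0) => w Lw _ /=.
  by rewrite funenegE; apply/max_idPr; rewrite leeNl oppe0.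
have /(ae_eq_integral_abs P measurableT)[/(_ neg0) + _] :=
  measurable_integral_on lebesgue_measure mD (measurable_funeneg (mL n))
    (fun _ _ => funeneg_ge0 _ _).
apply: filterS => w /(_ I) /= w0.
rewrite cumulativeE w0 sube0.
congr fine; rewrite /B.
transitivity (\int[lebesgue_measure]_(s in D) ((L n)^\+ (s, w) + (L n)^\- (s, w))).
  rewrite ge0_integralD//.
  - by rewrite w0 adde0.
  - exact: measurable_fun_section1 (measurable_funepos (mL n)).
  - exact: measurable_fun_section1 (measurable_funeneg (mL n)).
apply: eq_integral => s _.
by have /(congr1 (@^~ (s, w)))/= := fune_abse (L n).
Qed.

Lemma cumulative_process_L2_limit (M : R) :
  (forall n, \int[lebesgue_measure]_(s in D) \int[lebesgue_measure]_(u in D)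
    (\prod_(i < n) r (`|s - u| * b ^+ i))%:E <= M%:E) ->
  exists A : T -> R, measurable_fun setT A /\
    forall q : R, (0 <= q <= 2)%R -> cvg_Lq P q (fun n => cumulative_process Y n t) A.
Proof.
move=> KM.
pose K n := \int[lebesgue_measure]_(s in D) \int[lebesgue_measure]_(u in D)
    (\prod_(i < n) r (`|s - u| * b ^+ i))%:E.
have B0 n w : 0 <= B n w by exact: integral_ge0.
have mB n : measurable_fun setT (B n).
  exact: (measurable_integral_on lebesgue_measure mD (mnorm n)).
have mBB m n : measurable_fun setT (fun w => B m w * B n w) by exact: emeasurable_funM.
have K0 n : 0 <= K n.+1.
  by rewrite /K -(integral_mul_cumulative (leqnn n));
    apply: integral_ge0 => w _; rewrite mule_ge0.
have KE n : K n.+1 = (fine (K n.+1))%:E.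
  by rewrite fineK// ge0_fin_numE// (le_lt_trans (KM _))// ltry.
pose X n w := fine (B n w).
have mX n : measurable_fun setT (X n).
  exact: (measurableT_comp (fine_measurable measurableT)).
have X0 n w : (0 <= X n w)%R by exact: fine_ge0.
(* A finite second moment forces [B n] to be finite a.e. *)
have BX n : {ae P, forall w, B n w = (X n w)%:E}.
  have BBfin : P.-integrable setT (fun w => B n w * B n w).
    apply/integrableP; split => //.
    under eq_integral do rewrite gee0_abs ?mule_ge0//.
    by rewrite integral_mul_cumulative// (le_lt_trans (KM _))// ltry.
  apply: filterS (integrable_ae measurableT BBfin) => w /(_ I).
  rewrite /X; case: (B n w) (B0 n w) => //=.
(* The index is [m.+1] because [product_process] at [m] has m + 1 factors. *)
have XX m n : (m <= n)%N -> \int[P]_w (X m w * X n w)%:E = (fine (K m.+1))%:E.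
  move=> mn; rewrite -KE /K -(integral_mul_cumulative mn).
  apply: ae_eq_integral => //.
    by apply/measurable_EFinP; exact: measurable_funM.
  by apply: filterS2 (BX m) (BX n) => w -> -> _; rewrite EFinM.
have kM n : (fine (K n.+1) <= M)%R by rewrite -lee_fin -KE; exact: KM.
pose A n := cumulative_process Y n t.
have mA n : measurable_fun setT (A n) by exact: measurable_cumulative_process.
have AX n : {ae P, forall w, A n w = X n w} by exact: cumulative_process_ae.
have AA_XX m n : \int[P]_w ((A n w - A m w) ^+ 2)%:E =
    \int[P]_w ((X n w - X m w) ^+ 2)%:E.
  apply: ae_eq_integral => //.
  - by apply/measurable_EFinP/measurable_funX/measurable_funB.
  - by apply/measurable_EFinP/measurable_funX/measurable_funB.
  - by apply: filterS2 (AX m) (AX n) => w -> -> _.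
have [e e0|Z [mZ AZ]] := @L2_complete _ _ _ P A mA.
  have [N NP] := square_integrable_martingale_cauchy mX X0 XX kM e0.
  by exists N => m n Nm Nn; rewrite AA_XX; exact: NP.
exists Z; split => // q q02; apply: L2_cvg_Lq => //.
have [N NP] := AZ 1%R ltr01.
(* Square integrability of the limit, from z^2 <= 2 (a - z)^2 + 2 a^2 at an index where the L_2
   distance is at most 1. *)
apply: (@le_lt_trans _ _ (\int[P]_w (2%:E * ((A N w - Z w) ^+ 2)%:E +
    2%:E * (X N w * X N w)%:E))).
  have mAZ : measurable_fun setT (fun w => ((A N w - Z w) ^+ 2)%:E).
    by apply/measurable_EFinP/measurable_funX/measurable_funB.
  have mXN : measurable_fun setT (fun w => (X N w * X N w)%:E).
    by apply/measurable_EFinP; exact: measurable_funM.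
  apply: ae_ge0_le_integral => //.
  - by move=> w _; rewrite lee_fin sqr_ge0.
  - by apply/measurable_EFinP; exact: measurable_funX.
  - by move=> w _; rewrite -!EFinM -EFinD lee_fin addr_ge0// mulr_ge0// sqr_ge0.
  - by apply: emeasurable_funD; exact: emeasurable_funM.
  - apply: filterS (AX N) => w <- _; rewrite -!EFinM -EFinD lee_fin.
    rewrite -subr_ge0 (_ : _ - _ = (2 * A N w - Z w) ^+ 2)%R ?sqr_ge0//.
    by move: (A N w) (Z w) => x y; ring.
rewrite ge0_integralD//; last 4 first.
- by move=> w _; rewrite -EFinM lee_fin mulr_ge0// sqr_ge0.
- by apply: emeasurable_funM => //; apply/measurable_EFinP/measurable_funX/measurable_funB.
- by move=> w _; rewrite -EFinM lee_fin mulr_ge0// mulr_ge0.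
- by apply: emeasurable_funM => //; apply/measurable_EFinP; exact: measurable_funM.
rewrite !ge0_integralZl//; last 4 first.
- by apply/measurable_EFinP; exact: measurable_funM.
- by move=> w _; rewrite lee_fin mulr_ge0.
- by apply/measurable_EFinP/measurable_funX/measurable_funB.
- by move=> w _; rewrite lee_fin sqr_ge0.
rewrite XX//; apply: (@le_lt_trans _ _ (2%:E * 1%:E + 2%:E * (fine (K N.+1))%:E)).
  by rewrite leeD2r// lee_pmul2l//; exact: NP.
by rewrite -!EFinM -EFinD ltry.
Qed.

End cumulative.

(** * Transfer from the mother process to the rescaled copies *)

Theorem theorem1 (R : realType)
  (d0 : measure_display) (T0 : measurableType d0) (P0 : probability T0 R)
  (Lambda : R -> T0 -> R) (hLambda : mother_process P0 Lambda)
  (b : R) (hb : 1 < b)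
  (d : measure_display) (T : measurableType d) (P : probability T R)
  (* independent copies of the mother process *)
  (L : nat -> R -> T -> R)
  (hL : forall i, mother_process P (L i))
  (hLcopy : forall i, same_fdd P P0 (L i) Lambda)
  (hLindep : independent_processes P L)
  (* independent rescaled copies *)
  (Lb : nat -> R -> T -> R)
  (hLbmeas : forall i, measurable_process (Lb i))
  (hLbsep : forall i, separable_process P (Lb i))
  (hLbfdd : forall i, same_fdd P P (Lb i) (fun t => L i (t * b ^+ i)))
  (hLbindep : independent_processes P Lb)
  (hrho : forall u v : R, 0 <= u -> u <= v ->
    (autocorrelation P0 Lambda v <= autocorrelation P0 Lambda u)%E)
  (hb2 : ('E_P0[fun w => (Lambda 0 w ^+ 2)%R] < b%:E)%E)
  (hsum : (\sum_(0 <= i <oo)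
     (autocorrelation P0 Lambda (b ^+ i)%R - 1) < +oo)%E) :
  forall t : R, 0 <= t <= 1 ->
    exists A : T -> R,
      [/\ measurable_fun setT A,
          cvg_Lq P 2 (fun n => cumulative_process Lb n t) A &
          forall q : R, 0 <= q <= 2 ->
            cvg_Lq P q (fun n => cumulative_process Lb n t) A].
Proof.
move=> t t01.
pose r u := fine (autocorrelation P0 Lambda u).
have hb20 : (autocorrelation P0 Lambda 0 < b%:E)%E by exact: hb2.
(* Finiteness comes from monotonicity: every value is at most the one at 0, which is below [b]. *)
have rE u : 0 <= u -> autocorrelation P0 Lambda u = (r u)%:E.
  move=> u0; rewrite fineK// ge0_fin_numE.
    by rewrite (le_lt_trans (hrho _ _ (lexx 0) u0))// (lt_le_trans hb20)// leey.
  by rewrite -autocorrelationE//; apply: integral_ge0 => w _; rewrite lee_fin.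
have r_le u v : 0 <= u -> u <= v -> r v <= r u.
  by move=> u0 uv; rewrite -lee_fin -!rE ?(le_trans u0 uv)//; exact: hrho.
have r_ge1 u : 0 <= u -> 1 <= r u.
  by move=> u0; exact: (autocorrelation_ge1 hLambda rE r_le u0).
have r0b : r 0 < b by rewrite -lte_fin -rE.
have b0 : 0 < b by exact: lt_trans hb.
have bi0 i : 0 <= b ^+ i by rewrite exprn_ge0// ltW.
pose S := (\sum_(0 <= i <oo) (autocorrelation P0 Lambda (b ^+ i)%R - 1))%E.
have term_ge0 i : (0 <= autocorrelation P0 Lambda (b ^+ i)%R - 1)%E.
  by rewrite rE// -EFinB lee_fin subr_ge0 r_ge1.
(* The constant comes from x <= exp(x - 1); as r >= 1, the partial sums stay below the full
   series. *)
have prod_le n : \prod_(i < n) r (b ^+ i) <= expR (fine S).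
  apply: (@le_trans _ _ (expR (\sum_(i < n) (r (b ^+ i) - 1)))).
    rewrite expR_sum; apply: ler_prod => i _.
    rewrite (le_trans ler01 (r_ge1 _ _))//=.
    by have := expR_ge1Dx (r (b ^+ i) - 1); rewrite addrC subrK.
  rewrite ler_expR -lee_fin fineK; last first.
    by rewrite ge0_fin_numE// nneseries_ge0.
  rewrite -sumEFin -(big_mkord xpredT (fun i => (r (b ^+ i) - 1)%:E)).
  under eq_bigr do rewrite EFinB -rE//.
  exact: nneseries_lim_ge.
have Lbt i s : 0 <= s -> measurable_fun setT (Lb i s).
  exact: measurable_process_section.
have Lt i s : 0 <= s -> measurable_fun setT (L i s).
  exact: (measurable_process_section (mother_measurable (hL i))).
have Lambdat s : 0 <= s -> measurable_fun setT (Lambda s).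
  exact: (measurable_process_section (mother_measurable hLambda)).
have Lbi i s : 0 <= s -> measurable_fun setT (L i (s * b ^+ i)).
  by move=> s0; apply: Lt; rewrite mulr_ge0.
have ELb i s : 0 <= s -> (\int[P]_w `|Lb i s w|%:E = 1)%E.
  move=> s0; rewrite (same_fdd_integral1 (Lbt i) (Lbi i) (hLbfdd i) s0
    (h := fun x => `|x|))//.
  by rewrite mother_norm// mulr_ge0.
have ELbLb i s u : 0 <= s -> 0 <= u ->
    (\int[P]_w (`|Lb i s w| * `|Lb i u w|)%:E = (r (`|s - u| * b ^+ i))%:E)%E.
  move=> s0 u0.
  (* Two transfers of law: to [L i] at the times s b^i and u b^i, then to [Lambda], where
     stationarity leaves only the lag |s - u| b^i. *)
  rewrite (same_fdd_integral_norm_mul (Lbt i) (Lbi i) (hLbfdd i) s0 u0).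
  rewrite (same_fdd_integral_norm_mul (Lt i) Lambdat (hLcopy i)) ?mulr_ge0//.
  rewrite mother_norm_mul ?mulr_ge0// -mulrBl normrM (ger0_norm (bi0 i)) rE//.
  by rewrite mulr_ge0.
have Lb_ge0 i s : 0 <= s -> {ae P, forall w, 0 <= Lb i s w}.
  move=> s0.
  have m0 (x : R) : 0 <= Num.max (- x) 0 by rewrite le_max lexx orbT.
  have mmax : measurable_fun setT (fun x : R => Num.max (- x) 0).
    by apply: measurable_maxr => //; exact: measurableT_comp.
  have mneg : measurable_fun setT (fun w => (Num.max (- Lb i s w) 0)%:E).
    by apply/measurable_EFinP; exact: (measurableT_comp mmax (Lbt i s s0)).
  (* The expected negative part depends only on the law at time [s], so it vanishes for [Lb i] as it
     does for the mother process. *)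
  have /(ae_eq_integral_abs P measurableT mneg) :
      (\int[P]_w `|(Num.max (- Lb i s w) 0)%:E| = 0)%E.
    under eq_integral do rewrite gee0_abs ?lee_fin//.
    rewrite (same_fdd_integral1 (Lbt i) (Lbi i) (hLbfdd i) s0 mmax)//.
    by rewrite mother_neg_part// mulr_ge0.
  apply: filterS => w /(_ I) [max0].
  by rewrite -oppr_le0 -max0 le_max lexx.
have [A [mA cA]] := cumulative_process_L2_limit hLbmeas hLbindep ELb ELbLb Lb_ge0
   (fun n => integral_prod_scaled_le hb r_ge1 r_le prod_le n r0b t01).
by exists A; split => //; apply: cA; rewrite ler0n lexx.
Qed.
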